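(* Let $r,m$ and $\alpha>\beta$ be positive integers and let $q$ be any prime power. Let $F(X)=X^r\left(X^{\alpha(q-1)}+X^{\beta(q-1)}+1\right)$ and $G(X)=X^{2\alpha-r}\left(X^{\alpha(q-1)}+X^{(\alpha-\beta)(q-1)}+1\right)$. If $F$ and $G$ are permutation polynomials of $\mathbb{F}_{q^2}$, then $F$ and $G$ are QM equivalent over $\mathbb{F}_{q^2}$.
   Context: Two permutation polynomials $f,g\in\mathbb{F}_{Q}[X]$ of $\mathbb{F}_Q$ are called quasi-multiplicative (QM) equivalent if there exist an integer $1\le d<Q-1$ with $\gcd(d,Q-1)=1$ and elements $\alpha',\beta'\in\mathbb{F}_Q^*$ such that $f(X)=\alpha'\, g(\beta' X^d)$. Here $Q=q^2$.
   Formalization: The equality f(X)=α'g(β'X^d) in QM equivalence is read modulo X^Q−X, i.e. as maps on F_Q, since literal equality of polynomials fails (q=2, r=1, α=3, β=1); if 2α<r, X^(2α−r) is read as the map x→x^(2α−r) with 0→0. *)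

(* Defs.v *)
From HB Require Import structures.
From mathcomp Require Import all_boot all_order all_algebra all_field.

Set Implicit Arguments.
Unset Strict Implicit.
Unset Printing Implicit Defensive.

Import GRing.Theory.
Local Open Scope ring_scope.

Definition prime_power (q : nat) : Prop :=
  exists p k : nat, [/\ prime p, (0 < k)%N & q = (p ^ k)%N].

Definition permutation_poly (L : finFieldType) (f : {poly L}) : Prop :=
  bijective (fun x : L => f.[x]).

(* Polynomials are compared modulo 'X^#|L| - 'X, i.e. as functions on L: for
   literal equality in {poly L} the bound d < #|L| - 1 would be meaningless
   and degrees alone would separate most pairs of permutation polynomials. *)
Definition qm_equiv (L : finFieldType) (f g : {poly L}) : Prop :=
  exists (d : nat) (a b : L),
    [/\ (1 <= d < #|L| - 1)%N, coprime d (#|L| - 1), a != 0, b != 0 &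
        f %% ('X^#|L| - 'X)
        = (a *: (g \Po (b *: 'X^d))) %% ('X^#|L| - 'X)].

(* 'X^k for k : int, as a polynomial over a finite field. For k >= 0 this is
   the ordinary monomial; for k < 0, 'X^-1 is represented by 'X^(#|L| - 2). *)
Definition Xz (L : finFieldType) (k : int) : {poly L} :=
  match k with
  | Posz n => 'X^n
  | Negz n => 'X^(#|L| - 2) ^+ n.+1
  end.

Lemma horner_Xz (L : finFieldType) (k : int) (x : L) :
  (2 < #|L|)%N -> (Xz L k).[x] = x ^ k.
Proof.
move=> L2; case: k => n /=; first by rewrite hornerXn.
rewrite horner_exp hornerXn NegzE -exprnN -exprVn; congr (_ ^+ _).
have [->|x0] := eqVneq x 0; first by rewrite invr0 expr0n subn_eq0 leqNgt L2.
apply: (mulfI x0); rewrite divff // -exprS; apply: (mulfI x0).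
rewrite mulr1 -exprS; have -> : (#|L| - 2).+2 = #|L| by rewrite -addn2 subnK // ltnW.
exact: expf_card.
Qed.

(* Main.v *)
(** On nonzero x, with u = x^(q-1) and h(u) = u^alpha + u^beta + 1, one has
    F(x) = x^r h(u), and G(x) = x^e h(u)^q with e = (q+1) alpha - r, because
    u^q = u^-1.  Bijectivity forces gcd(r, q-1) = gcd(e, q-1) = 1: the common
    roots of unity could otherwise be absorbed into x.  If q+1 divides d+1 then
    h(u^d)^q = h(u^(dq)) = h(u), so G(x^d) = x^(de) h(u), which is F(x) as soon
    as de = r modulo q^2-1.  Writing d = (q+1) t - 1 and using that q+1 divides
    r + e, the latter is a linear congruence for t modulo q-1 with invertible
    coefficient e; d is then prime to q+1, and prime to q-1 since r is. *)

Require Import Defs.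
From mathcomp Require Import all_boot all_order all_algebra all_field.
From mathcomp Require Import cyclic zify ring.

Import GRing.Theory.
Local Open Scope ring_scope.

(** The solution is [d = P * t - 1]: the congruence becomes [P * t * e = r + e = P * w] modulo
    [M * P], that is [t * e = w] modulo [M]. Bezout gives [1 + a * e] divisible by [M], so [M - a]
    inverts [e] and [t = (M - a) * w] works; [1 < P] makes [d] positive. *)
Lemma solve_congruence (M P e r w : nat) :
  (0 < M)%N -> (1 < P)%N -> (0 < w)%N -> coprime e M -> (r + e = P * w)%N ->
  exists d, [/\ (0 < d)%N, (P %| d.+1)%N & d * e = r %[mod M * P]].
Proof.
move=> M0 P1 w0 /eqP eM rew.
have [a ltaM] := Bezoutr e M0; rewrite eM => /dvdnP [b ab].
have t0 : (0 < (M - a) * w)%N by rewrite muln_gt0 subn_gt0 ltaM.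
have PT : (1 < P * ((M - a) * w))%N.
  by rewrite (leq_trans P1) // leq_pmulr.
exists (P * ((M - a) * w)).-1; split; first by lia.
  by rewrite prednK ?dvdn_mulr // ltnW.
apply/eqP; rewrite -(eqn_modDr e) -mulSnr prednK ?(ltnW PT) // rew.
rewrite -mulnA (mulnC M) -!muln_modr; apply/eqP; congr (_ * _)%N.
apply/eqP; rewrite -(eqn_modDr (a * w * e)).
have -> : ((M - a) * w * e + a * w * e = M * (w * e))%N by nia.
have -> : (w + a * w * e = M * (b * w))%N by nia.
by rewrite !modnMr.
Qed.

(** The modulus is the product of the distinct factors ['X - x] over all [x] in [L], so it divides
    any polynomial vanishing on [L]. *)
Lemma eq_horner_modp (L : finFieldType) (f g : {poly L}) :
  (forall x, f.[x] = g.[x]) -> f %% ('X^#|L| - 'X) = g %% ('X^#|L| - 'X).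
Proof.
move=> fg; apply/eqP; rewrite -subr_eq0 -modpN -modpD -/(_ %| _).
rewrite finField_genPoly; apply: uniq_roots_dvdp.
  by apply/allP => x _; rewrite rootE !hornerE fg subrr.
by rewrite uniq_rootsE index_enum_uniq.
Qed.

Lemma expf_card_pred (L : finFieldType) (x : L) : x != 0 -> x ^+ #|L|.-1 = 1.
Proof.
move=> x0; apply: (mulfI x0); rewrite mulr1 -exprS prednK ?expf_card //.
by apply/card_gt0P; exists x.
Qed.

Lemma expf_modn (L : finFieldType) (x : L) (i j : nat) :
  x != 0 -> i = j %[mod #|L|.-1] -> x ^+ i = x ^+ j.
Proof.
by move=> /expf_card_pred xN ij; rewrite -(expr_mod i xN) ij expr_mod.
Qed.

Lemma exists_prim_root_card (L : finFieldType) :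
  exists z : L, #|L|.-1.-primitive_root z.
Proof.
have cardN : #|predC1 (0 : L)| = #|L|.-1 by rewrite cardC1.
have/hasP[z _ zP]: has #|L|.-1.-primitive_root (enum (predC1 (0 : L))).
  apply: has_prim_root; rewrite ?enum_uniq -?cardE ?cardN //.
    by rewrite -cardN; apply/card_gt0P; exists 1; rewrite inE oner_eq0.
  apply/allP => x; rewrite mem_enum inE => x0.
  by apply/unity_rootP/expf_card_pred.
by exists z.
Qed.

(** An element [w] of order [gcdn e M] has [w ^+ e = w ^+ M = 1], so [f] takes the same value at [w]
    and at 1. *)
Lemma perm_poly_coprime (L : finFieldType) (M e : nat) (h : L -> L)
    (f : {poly L}) :
  (M %| #|L|.-1)%N -> permutation_poly f ->
  (forall x, x != 0 -> f.[x] = x ^+ e * h (x ^+ M)) -> coprime e M.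
Proof.
move=> MN /bij_inj injf fE; have [z zP] := exists_prim_root_card L.
have gN : (gcdn e M %| #|L|.-1)%N by apply: dvdn_trans MN; apply: dvdn_gcdr.
have := dvdn_prim_root zP gN; set w := z ^+ _ => wP.
have we : w ^+ e = 1 by apply/eqP; rewrite -(prim_order_dvd wP) dvdn_gcdl.
have wM : w ^+ M = 1 by apply/eqP; rewrite -(prim_order_dvd wP) dvdn_gcdr.
have w0 : w != 0.
  apply: contra_eq_neq (prim_expr_order wP) => ->.
  by rewrite expr0n gtn_eqF ?(prim_order_gt0 wP) // eq_sym oner_eq0.
have w1 : w = 1.
  by apply: injf; rewrite !fE ?oner_eq0 // we wM !expr1n.
by move: (prim_order_dvd wP 1); rewrite w1 expr1n eqxx dvdn1.
Qed.

Theorem theorem6p2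
  (r m alpha beta q : nat)
  (hr : (0 < r)%N) (hm : (0 < m)%N)
  (hbeta : (0 < beta)%N) (hab : (beta < alpha)%N)
  (hq : prime_power q)
  (L : finFieldType) (hL : #|L| = (q ^ 2)%N)
  (F G : {poly L})
  (hF : F = 'X^r * ('X^(alpha * (q - 1)) + 'X^(beta * (q - 1)) + 1))
  (hG : G = Xz L ((2 * alpha)%:Z - r%:Z)
            * ('X^(alpha * (q - 1)) + 'X^((alpha - beta) * (q - 1)) + 1))
  (permF : permutation_poly F) (permG : permutation_poly G) :
  qm_equiv F G.
Proof.
have [q1 frob q0] : [/\ (1 < q)%N,
    forall x y : L, (x + y) ^+ q = x ^+ q + y ^+ q & q%:R = 0 :> L].
  case: hq => p [k [pp k0 qE]].
  have pL : p \in [pchar L].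
    by apply: (@card_finPcharP _ p (k * 2)) => //; rewrite hL qE expnM.
  split.
  - by rewrite qE -(exp1n k) ltn_exp2r ?prime_gt1.
  - move=> x y; apply: exprDn_pchar; rewrite qE pnatX.
    by apply/orP; left; rewrite pnatE.
  - by apply/eqP; rewrite -(dvdn_pcharf pL) qE dvdn_exp.
(* From here on [M] is q - 1, so q is [M.+1] and q + 1 is [M.+2]. *)
case: q q1 frob q0 hL {hq} hF hG => // M; rewrite ltnS => M0 frob q0 hL.
rewrite subn1 /= => hF hG.
have cN : #|L|.-1 = (M * M.+2)%N by rewrite hL; lia.
have L2 : (2 < #|L|)%N by rewrite hL; nia.
pose h (u : L) := u ^+ alpha + u ^+ beta + 1.
have hFrob u : h u ^+ M.+1 = h (u ^+ M.+1).
  by rewrite /h !frob expr1n -!exprM !(mulnC M.+1).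
have FE x : F.[x] = x ^+ r * h (x ^+ M).
  by rewrite hF /h !hornerE -!exprM !(mulnC M).
(* A natural number representing (q+1) alpha - r modulo [#|L|.-1]: the factor [#|L|.-1.-1] stands
   for -1. *)
pose e := (M.+2 * alpha + #|L|.-1.-1 * r)%N.
have N0 : (0 < #|L|.-1)%N by lia.
have re : (r + e = M.+2 * (alpha + M * r))%N.
  have -> : (r + e = M.+2 * alpha + #|L|.-1 * r)%N by rewrite /e; nia.
  by rewrite cN; nia.
have GE x : x != 0 -> G.[x] = x ^+ e * h (x ^+ M) ^+ M.+1.
  (* Multiplying by [x ^ r] clears the possibly negative exponent. The monomials then match in
     reverse order: the alpha, beta and constant terms of [h] give the constant, [alpha - beta] and
     alpha terms of [G]. *)
  move=> x0; have xr0 : x ^ r != 0 by rewrite expf_neq0.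
  apply: (mulfI xr0); rewrite hG hornerM horner_Xz // mulrA -expfzDr //.
  rewrite addrC subrK mulrA -!exprnP -exprD re hFrob /h !hornerE.
  rewrite -!exprM !mulrDr !mulr1 -!exprD.
  rewrite -[LHS]addrA [LHS]addrC [X in X + _ = _]addrC; congr (_ + _ + _); apply: expf_modn => //.
  1-3: rewrite cN; apply/eqP.
  - have -> : (M.+2 * (alpha + M * r) + M * (M.+1 * alpha)
               = (alpha + r) * (M * M.+2) + 2 * alpha)%N by nia.
    by rewrite modnMDl.
  - have -> : (M.+2 * (alpha + M * r) + M * (M.+1 * beta)
       = (r + beta) * (M * M.+2) + (2 * alpha + (alpha - beta) * M))%N by nia.
    by rewrite modnMDl.
  - have -> : (M.+2 * (alpha + M * r)
               = r * (M * M.+2) + (2 * alpha + alpha * M))%N by nia.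
    by rewrite modnMDl.
have MN : (M %| #|L|.-1)%N by rewrite cN dvdn_mulr.
have rM : coprime r M := perm_poly_coprime L M r h F MN permF (fun x _ => FE x).
have eM : coprime e M :=
  perm_poly_coprime L M e (fun u => h u ^+ M.+1) G MN permG GE.
have w0 : (0 < alpha + M * r)%N by rewrite ltn_addr // (leq_trans hbeta) // ltnW.
have [d0 [d00 Pd0 d0e]] := solve_congruence M M.+2 e r _ M0 isT w0 eM re.
(* Reduction modulo q^2 - 1 meets the upper bound on the exponent without changing the power map on
   nonzero elements. *)
pose d := (d0 %% (M * M.+2))%N.
have cop : coprime d0 (M * M.+2).
  rewrite coprimeMr; apply/andP; split.
    have : coprime (d0 * e) M.
      rewrite -coprime_modl -(@modn_dvdm (M * M.+2)) ?dvdn_mulr // d0e.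
      by rewrite modn_dvdm ?dvdn_mulr // coprime_modl.
    by rewrite coprimeMl => /andP[].
  by apply: (coprime_dvdr Pd0); rewrite coprimenS.
have cop' : coprime d (M * M.+2) by rewrite coprime_modl.
have d_gt0 : (0 < d)%N.
  rewrite lt0n; apply: contraTneq cop' => ->.
  by rewrite /coprime gcd0n muln_eq1 andbF.
have G0 : G.[0] = 0.
  rewrite hG hornerM horner_Xz // exp0rz subr_eq0.
  (* The delicate case is [r = 2 * alpha], where the monomial factor of [G] is 1. Then [M] divides
     [e], so coprimality forces q = 2, and in characteristic 2 both [G.[0]] and [G.[1]] equal 1,
     against injectivity. *)
  case: eqP => [[ar]|_]; last by rewrite mul0r.
  have M1 : M = 1%N.
    apply/eqP; rewrite -dvdn1 -(eqP eM) dvdn_gcd dvdnn andbT.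
    have ar' : (2 * alpha = r)%N by case: ar.
    apply/dvdnP; exists (alpha + M.+2 * r)%N; apply: (@addnI r).
    by rewrite re mulnDr mulnDl -{2}ar'; ring.
  have G01 : G.[0] = G.[1].
    rewrite (GE 1) ?oner_eq0 // hFrob /h !expr1n mul1r hG hornerM horner_Xz //.
    rewrite ar subrr mul1r !hornerE !expr0n M1.
    rewrite !muln1 !gtn_eqF ?subn_gt0 ?(ltn_trans hbeta) //.
    by move: q0; rewrite M1 mulr2n => ->; rewrite !add0r.
  by have /eqP := bij_inj permG G01; rewrite eq_sym oner_eq0.
exists d, 1, 1; split; rewrite ?oner_eq0 //.
- by rewrite subn1 cN d_gt0 ltn_mod muln_gt0 M0.
- by rewrite subn1 cN.
apply: eq_horner_modp => x; rewrite !scale1r horner_comp hornerXn FE.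
have [->|x0] := eqVneq x 0.
  rewrite !expr0n !gtn_eqF ?mul0r ?G0 //.
have -> : x ^+ d = x ^+ d0 by apply: expf_modn; rewrite // cN modn_mod.
rewrite GE ?expf_neq0 // hFrob -!exprM; congr (_ * h _); apply: expf_modn => //.
  by rewrite cN d0e.
rewrite cN; case/dvdnP: Pd0 => c cE; apply/eqP.
(* Adding [M * M.+1] turns both sides into multiples of [M * M.+2], the right one because [M.+2]
   divides [d0.+1]. *)
rewrite -(eqn_modDr (M * M.+1)).
have -> : (M + M * M.+1 = M * M.+2)%N by nia.
have -> : (d0 * M * M.+1 + M * M.+1 = c * M.+1 * (M * M.+2))%N.
  by rewrite -mulnA -mulSnr cE; ring.
by rewrite modnn modnMl.
Qed.
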